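(* Let $D$ be an oriented split graph whose vertex set is partitioned into $X$ and $Y$ such that $X$ is an independent set and $D[Y]$ is an almost regular tournament of order $2d$. Then $D$ has a Seymour vertex, i.e. a vertex $u$ with $|N^{++}(u)|\ge |N^+(u)|$.
   Context: An oriented graph is a loopless digraph in which $xy\in A$ implies $yx\notin A$; $D$ is assumed to be such. A tournament is almost regular if $|d^+(x)-d^-(x)|=1$ for each vertex $x$. $N^+(u)=\{v:uv\in A(D)\}$, $N^{++}(u)=\{v: uw,wv\in A(D)\text{ for some } w\}\setminus N^+(u)$. *)

(* Defs.v *)
From mathcomp Require Import all_boot all_order all_algebra.

Set Implicit Arguments.
Unset Strict Implicit.
Unset Printing Implicit Defensive.

Import GRing.Theory Num.Theory.

(** A digraph on a finite vertex set [T] is its arc relation [D : rel T]. *)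

Definition oriented (T : finType) (D : rel T) : Prop :=
  irreflexive D /\ forall x y : T, D x y -> ~~ D y x.

Definition tournament (T : finType) (D : rel T) : Prop :=
  oriented D /\ forall x y : T, x != y -> D x y || D y x.

Definition independent (T : finType) (D : rel T) (X : {set T}) : Prop :=
  {in X &, forall x y : T, ~~ D x y}.

Definition induced (T : finType) (D : rel T) (Y : {set T}) :
    rel {x : T | x \in Y} :=
  relpre val D.

Arguments induced [T] D Y _ _.

Definition out_nbhd (T : finType) (D : rel T) (u : T) : {set T} :=
  [set v | D u v].

Definition in_nbhd (T : finType) (D : rel T) (u : T) : {set T} :=
  [set v | D v u].

Definition out_nbhd2 (T : finType) (D : rel T) (u : T) : {set T} :=
  [set v | [exists w, D u w && D w v]] :\: out_nbhd D u.

Definition almost_regular (T : finType) (D : rel T) : Prop :=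
  forall x : T, (`|#|out_nbhd D x|%:Z - #|in_nbhd D x|%:Z| = 1)%R.

Definition seymour_vertex (T : finType) (D : rel T) (u : T) : Prop :=
  #|out_nbhd D u| <= #|out_nbhd2 D u|.

(* Main.v *)
(** Suppose that no vertex is Seymour; degrees below are taken inside [Y]. A
    vertex [y] of [Y] already has almost enough second out-neighbours inside [Y],
    so the number of vertices of [X] in its second out-neighbourhood is at most
    the number in its out-neighbourhood, with slack 1 when [y] has out-degree
    [d - 1] and slack 2 when moreover nothing in [Y] dominates [y] and its
    out-neighbours. It follows that every [y] has an out-neighbour in [X], and
    then that every [x] in [X] has more than [d] out-neighbours.

    Summing over [Y] and exchanging the sums, each [x] contributes at most 1, and
    exactly 1 when [x] is "tight": its in-neighbourhood [I] is larger by one than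
    the set of its second in-neighbours in [Y]. Counting arcs between [I] and the
    remaining set [F] of [2d - 2|I| + 1] vertices, all dominated by [I], shows that
    [3|I| > 2d] and that all of [F] has slack 2. Hence there are at least
    [d + |F|] tight vertices.

    Finally sum only over [W], the out-neighbourhood of one tight [x], with
    [|W| = d + t]. As [x] is not Seymour, at most [2t - 1] vertices of [X] are
    reached from [W]; each contributes at most [d - t + 1], while each of the other
    tight vertices, at least [d + 2] in number, contributes at most
    [- (3t + d - 1) / 3]. The total is negative, a contradiction. *)

Require Import Defs.
From mathcomp Require Import all_boot all_order all_algebra zify.

Set Implicit Arguments.
Unset Strict Implicit.
Unset Printing Implicit Defensive.

(** * Arc counts in tournaments *)

Section TournamentCounting.

Variable T : finType.
Implicit Types (E : rel T) (A B S Y : {set T}) (d : nat).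

Definition out_in E S y : {set T} := [set v in S | E y v].
Definition rev_rel E : rel T := fun x y => E y x.
Definition tournament_on E S := {in S &, forall x y, E x y + E y x = (x != y)}.

Lemma card_out_in E S y : #|out_in E S y| = \sum_(v in S) E y v.
Proof.
rewrite -sum1_card [RHS](bigID (E y)) /= [X in _ + X]big1 ?addn0; last first.
  by move=> v /andP[_ /negPf->].
by apply: eq_big => v; [rewrite inE | rewrite inE => /andP[_ ->]].
Qed.

Lemma sum_card_out_in E A B :
  \sum_(y in A) #|out_in E B y| = \sum_(v in B) #|out_in (rev_rel E) A v|.
Proof.
under eq_bigr do rewrite card_out_in.
by rewrite exchange_big; apply: eq_bigr => v _; rewrite card_out_in.
Qed.

Lemma tournament_on_rev E S : tournament_on E S -> tournament_on (rev_rel E) S.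
Proof. by move=> tE x y xS yS; rewrite /rev_rel addnC tE. Qed.

Lemma tournament_onS E A B :
  A \subset B -> tournament_on E B -> tournament_on E A.
Proof. by move=> /subsetP sAB tE x y /sAB xB /sAB; apply: tE. Qed.

(** Exchanging one copy of the sum turns it into in-degrees; out-degree plus in-degree is [#|S|.-1]
    at each vertex. *)
Lemma tournament_on_arcs E S : tournament_on E S ->
  (\sum_(y in S) #|out_in E S y|).*2 = #|S| * #|S|.-1.
Proof.
move=> tE; rewrite -addnn {2}sum_card_out_in -big_split /= -sum_nat_const.
apply: eq_bigr => y yS; rewrite !card_out_in -big_split /=.
under eq_bigr => v vS do rewrite /rev_rel tE //.
rewrite (bigD1 y) //= eqxx add0n (cardsD1 y) yS /= -sum1_card.
apply: eq_big => v; first by rewrite !inE andbC.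
by case/andP=> _; rewrite eq_sym => ->.
Qed.

(** * A set [B] dominating [A], with out-degrees bounded by [d] *)

Section Domination.

Variables (E : rel T) (Y A B : {set T}) (d : nat).
Hypotheses (tE : tournament_on E Y) (sAY : A \subset Y) (sBY : B \subset Y).
Hypothesis domBA : {in B & A, forall b a, E b a}.
Hypothesis outB : {in B, forall b, #|out_in E Y b| <= d}.

Lemma dominating_out_sub b : b \in B ->
  A :|: out_in E B b \subset out_in E Y b.
Proof.
move=> bB; apply/subsetP => a; rewrite !inE => /orP[aA|/andP[aB ->]].
  by rewrite (subsetP sAY) // domBA.
by rewrite (subsetP sBY).
Qed.

Lemma dominating_out_card b : b \in B ->
  #|A :|: out_in E B b| = #|A| + #|out_in E B b|.
Proof.
move=> bB; rewrite cardsU -[RHS]subn0; congr subn.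
apply/eqP; rewrite cards_eq0; apply/eqP/setP => a; rewrite !inE.
apply/negP => /and3P[aA aB _].
have := tE (subsetP sBY _ aB) (subsetP sBY _ aB).
by rewrite eqxx domBA.
Qed.

Lemma dominating_out b : b \in B -> #|A| + #|out_in E B b| <= #|out_in E Y b|.
Proof.
by move=> bB; rewrite -dominating_out_card // subset_leq_card ?dominating_out_sub.
Qed.

(** Out-degrees inside [B] average [(#|B| - 1) / 2], and each leaves room for [#|A|] more within the
    bound [d]. *)
Lemma dominating_card : 0 < #|B| -> #|A|.*2 + #|B| <= d.*2.+1.
Proof.
move=> B0; have := tournament_on_arcs (tournament_onS sBY tE).
have : \sum_(b in B) (#|A| + #|out_in E B b|) <= \sum_(b in B) d.
  by apply: leq_sum => b bB; apply: leq_trans (dominating_out bB) (outB bB).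
rewrite big_split /= !sum_nat_const; set s := \sum_(_ in _) _ => le1 eq1.
have : #|B| * (#|A|.*2 + #|B|.-1) <= #|B| * d.*2 by nia.
rewrite leq_pmul2l //; lia.
Qed.

(** Equality in the averaging leaves no room for a vertex of [B] below the bound, nor for an
    out-neighbour outside [A] and [B]. *)
Lemma dominating_card_eq b : #|A|.*2 + #|B| = d.*2.+1 -> b \in B ->
  #|out_in E Y b| = d /\ out_in E Y b \subset A :|: B.
Proof.
move=> eqAB bB; have B0 : 0 < #|B| by apply/card_gt0P; exists b.
have le1 c : c \in B -> #|A| + #|out_in E B c| <= d.
  by move=> cB; apply: leq_trans (dominating_out cB) (outB cB).
have eq1 := tournament_on_arcs (tournament_onS sBY tE).
have eqb : #|A| + #|out_in E B b| = d.
  apply/eqP; rewrite eqn_leq le1 // leqNgt; apply/negP => ltb.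
  have : \sum_(c in B) (#|A| + #|out_in E B c|) < \sum_(c in B) d.
    rewrite (bigD1 b) //= [X in _ < X](bigD1 b) //= -addSn leq_add //.
    by apply: leq_sum => c /andP[cB _]; apply: le1.
  rewrite big_split /= !sum_nat_const; move: eq1; set s := \sum_(_ in _) _.
  nia.
have outb : #|out_in E Y b| = d.
  by apply/eqP; rewrite eqn_leq outB //= -eqb dominating_out.
split=> //.
have /eqP <- : A :|: out_in E B b == out_in E Y b.
  by rewrite eqEcard dominating_out_sub //= outb dominating_out_card ?eqb.
by rewrite setUS //; apply/subsetP => v; rewrite inE => /andP[].
Qed.

End Domination.
End TournamentCounting.

(** * Second neighbourhoods through [Y] in a digraph without Seymour vertices *)

Section SeymourFree.

Variables (T : finType) (D : rel T) (Y : {set T}) (d : nat).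

(** Intermediate vertices are restricted to [Y], so [second] only underestimates the second
    out-neighbourhood; this is the direction [second_lt] needs. *)
Definition reach2 y x := [exists w in Y, D y w && D w x].
Definition second y x := ~~ D y x && reach2 y x.
Definition far y x := ~~ D y x && ~~ reach2 y x.

Lemma card_out_in_split (A : {set T}) y :
  #|out_in D A y| + #|out_in second A y| + #|out_in far A y| = #|A|.
Proof.
rewrite !card_out_in -!big_split -sum1_card; apply: eq_bigr => v _ /=.
by rewrite /second /far; case: (D y v); case: (reach2 y v).
Qed.

Lemma card_in_in_split (A : {set T}) x :
  #|out_in (rev_rel D) A x| + #|out_in (rev_rel second) A x|
    + #|out_in (rev_rel far) A x| = #|A|.
Proof.
rewrite !card_out_in -!big_split -sum1_card; apply: eq_bigr => v _ /=.
by rewrite /rev_rel /second /far; case: (D v x); case: (reach2 v x).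
Qed.

Hypothesis asymD : forall x y, D x y -> ~~ D y x.
Hypothesis indepD : forall x y, x \notin Y -> y \notin Y -> ~~ D x y.
Hypothesis tY : tournament_on D Y.
Hypothesis outY : {in Y, forall y, #|out_in D Y y| <= d}.
Hypothesis inY : {in Y, forall y, #|out_in (rev_rel D) Y y| <= d}.
Hypothesis cardY : #|Y| = d.*2.
Hypothesis not_seymour : forall u, #|out_nbhd2 D u| < #|out_nbhd D u|.

Lemma card_out_inC (E : rel T) (A : {set T}) y :
  #|out_in E A y| + #|out_in E (~: A) y| = #|[set v | E y v]|.
Proof.
rewrite -(cardsID A [set v | E y v]); congr (_ + _); apply: eq_card => v.
  by rewrite !inE andbC.
by rewrite !inE.
Qed.

Lemma second_lt u :
  #|out_in second Y u| + #|out_in second (~: Y) u|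
    < #|out_in D Y u| + #|out_in D (~: Y) u|.
Proof.
rewrite !card_out_inC; apply: leq_ltn_trans (not_seymour u).
apply/subset_leq_card/subsetP => v; rewrite !inE => /andP[-> /=].
by move=> /existsP[w /andP[_ ?]]; apply/existsP; exists w.
Qed.

Lemma tournamentP y z : y \in Y -> z \in Y -> y != z -> ~~ D y z -> D z y.
Proof. by move=> yY zY yz /negPf Dyz; have := tY yY zY; rewrite yz Dyz; case: D. Qed.

Lemma irrD x : D x x = false.
Proof. by apply/negP => Dxx; have := asymD Dxx; rewrite Dxx. Qed.

Lemma out_addn_in y : y \in Y ->
  (#|out_in D Y y| + #|out_in (rev_rel D) Y y|).+1 = d.*2.
Proof.
move=> yY; rewrite -cardY !card_out_in -big_split /= -sum1_card.
rewrite (bigD1 y) //= [RHS](bigD1 y) //= /rev_rel irrD add0n add1n.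
congr _.+1; apply: eq_bigr => v /andP[vY vy].
by rewrite tY // eq_sym vy.
Qed.

(** * Degrees in [Y] and the slack of its vertices *)

Definition low y := #|out_in D Y y| < d.

Lemma out_low y : y \in Y -> #|out_in D Y y| + low y = d.
Proof.
move=> yY; rewrite /low; have := out_addn_in yY; have := outY yY; have := inY yY.
by case: ltnP; lia.
Qed.

(** The [d(2d - 1)] arcs of [Y] fall short of [2d] out-degrees equal to [d] by exactly [d]. *)
Lemma card_low : \sum_(y in Y) low y = d.
Proof.
have : \sum_(y in Y) (#|out_in D Y y| + low y) = d.*2 * d.
  by rewrite (eq_bigr _ out_low) sum_nat_const cardY.
rewrite big_split /=; have := tournament_on_arcs tY; rewrite cardY.
set s := \sum_(_ in _) #|_|; set l := \sum_(_ in _) _; nia.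
Qed.

(* The vertices of [Y] that keep [y] from having every in-neighbour in [Y] as a
   second out-neighbour. *)
Definition blockers y := [set z in Y | D z y & [forall w in Y, D y w ==> D z w]].

Lemma blocker_out y z : y \in Y -> z \in blockers y ->
  y |: out_in D Y y \subset out_in D Y z.
Proof.
move=> yY; rewrite !inE => /and3P[zY Dzy /forall_inP Dyz].
apply/subsetP => w; rewrite !inE => /predU1P[-> | /andP[wY Dyw]].
  by rewrite yY.
by rewrite wY; apply: (implyP (Dyz w wY)).
Qed.

(** The out-degree of [z] exceeds that of [y], and only [d - 1] and [d] occur. *)
Lemma blocker_low y z : y \in Y -> z \in blockers y -> low y && ~~ low z.
Proof.
move=> yY zB; have zY : z \in Y by move: zB; rewrite inE => /andP[].
have := subset_leq_card (blocker_out yY zB).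
rewrite cardsU1 !inE irrD andbF /=; have := out_low yY; have := out_low zY.
by have := outY zY; rewrite /low; do 2!case: ltnP; lia.
Qed.

(** Of two blockers one dominates the other, which would raise its out-degree to at least two more
    than that of [y]. *)
Lemma card_blockers y : y \in Y -> #|blockers y| <= 1.
Proof.
move=> yY; rewrite leqNgt; apply/negP => /card_gt1P[z1 [z2 [z1B z2B]]].
wlog Dz : z1 z2 z1B z2B / D z1 z2 => [IH z12|].
  have z1Y : z1 \in Y by move: z1B; rewrite inE => /andP[].
  have z2Y : z2 \in Y by move: z2B; rewrite inE => /andP[].
  case: (boolP (D z1 z2)) => [/IH|/(tournamentP z1Y z2Y z12)/IH]; first exact.
  by rewrite eq_sym => /(_ z2B z1B z12).
move=> z12; have z1Y : z1 \in Y by move: z1B; rewrite inE => /andP[].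
have [z2Y Dz2y] : z2 \in Y /\ D z2 y.
  by move: z2B; rewrite inE => /and3P[].
have : z2 |: (y |: out_in D Y y) \subset out_in D Y z1.
  by rewrite subUset blocker_out // sub1set inE z2Y Dz.
move/subset_leq_card; rewrite !cardsU1 !inE irrD andbF /=.
rewrite (negPf (asymD Dz2y)) andbF orbF.
have -> : (z2 == y) = false.
  by apply/eqP => z2y; rewrite z2y irrD in Dz2y.
have := out_low yY; have := outY z1Y; case: low => /=; lia.
Qed.

(** An in-neighbour of [y] in [Y] is a blocker or is dominated by some out-neighbour of [y]. This
    bounds the [Y] part of [second] from below, and [second_lt] moves the surplus to the
    complement. *)
Lemma second_gain y : y \in Y ->
  #|out_in second (~: Y) y| + low y + (low y && (blockers y == set0))
    <= #|out_in D (~: Y) y|.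
Proof.
move=> yY; have lt1 := second_lt y.
have le1 : #|out_in (rev_rel D) Y y| <= #|out_in second Y y| + #|blockers y|.
  apply: leq_trans (leq_card_setU _ _); apply/subset_leq_card/subsetP => z.
  rewrite !inE /rev_rel /second => /andP[zY Dzy]; rewrite zY Dzy asymD //=.
  case: (boolP [forall w in Y, _]) => [|/forall_inPn[w wY]]; first by rewrite orbT.
  rewrite negb_imply => /andP[Dyw nDzw]; rewrite orbF.
  apply/existsP; exists w; rewrite wY Dyw /=; apply: (tournamentP zY) => //.
  by apply: contraTneq Dyw => <-; apply: asymD.
have eq1 := out_addn_in yY; have eq2 := out_low yY.
have [Z0|[z zB]] := set_0Vmem (blockers y).
  by rewrite Z0 cards0 eqxx andbT in le1 *; case: low eq2 => /=; lia.
have := card_blockers yY; have /andP[ly _] := blocker_low yY zB.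
have -> : (blockers y == set0) = false.
  by apply/negbTE/set0Pn; exists z.
by rewrite ly /= in eq2 *; lia.
Qed.

(** By [second_gain], a vertex without out-neighbours outside [Y] is not low and its out-neighbours
    in [Y] have none either. Such vertices thus form a set closed under out-neighbours in [Y]. *)
Lemma out_compl_gt0 y : y \in Y -> 0 < #|out_in D (~: Y) y|.
Proof.
move=> yY; rewrite lt0n; apply/negP => P0.
(* A nonempty tournament with all out-degrees [d] has [2d + 1] vertices. *)
pose Y0 := [set z in Y | #|out_in D (~: Y) z| == 0].
have sY0 : Y0 \subset Y by apply/subsetP => z; rewrite inE => /andP[].
have outY0 z : z \in Y0 -> #|out_in D Y0 z| = d.
  rewrite inE => /andP[zY /eqP Pz]; have := second_gain zY; have := out_low zY.
  rewrite Pz !leqn0 !addn_eq0 => oz /andP[/andP[S0 /eqP l0] _].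
  rewrite -[RHS]oz l0 addn0; apply: eq_card => w; rewrite !inE.
  case: (boolP (w \in Y)) => //= wY; case: (boolP (D z w)) => [Dzw|]; last first.
    by rewrite andbF.
  rewrite andbT cards_eq0; apply/eqP/setP => x; rewrite !inE.
  apply/negP => /andP[xY Dwx]; move: Pz => /eqP; rewrite cards_eq0 => /eqP/setP/(_ x).
  rewrite !inE xY /= => /negbT nDzx.
  move: S0; rewrite cards_eq0 => /eqP/setP/(_ x); rewrite !inE xY /second nDzx /=.
  by move/existsP; case; exists w; rewrite wY Dzw.
have := tournament_on_arcs (tournament_onS sY0 tY).
rewrite (eq_bigr _ outY0) sum_nat_const.
have := subset_leq_card sY0; rewrite cardY.
have : 0 < #|Y0| by apply/card_gt0P; exists y; rewrite inE yY P0.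
nia.
Qed.

(** * Out-neighbourhoods of the vertices outside [Y] *)

Lemma far_out x : 0 < #|out_in far Y x| ->
  #|out_in D Y x|.*2 + #|out_in far Y x| <= d.*2.+1.
Proof.
apply: (dominating_card tY); try by apply/subsetP => z; rewrite inE => /andP[].
  (* An arc from [a] to [b] would make [b] reachable from [x] in two steps. *)
  move=> b a; rewrite !inE => /and3P[bY nDxb /existsPn nr] /andP[aY Dxa].
  apply: (tournamentP aY bY); first by apply: contraTneq Dxa => ->.
  by have := nr a; rewrite aY Dxa.
by move=> b; rewrite inE => /andP[/outY].
Qed.

Lemma out_compl_indep x : x \notin Y -> #|out_in D (~: Y) x| = 0.
Proof.
move=> xY; apply/eqP; rewrite cards_eq0; apply/eqP/setP => z; rewrite !inE.
by apply/negP => /andP[zY]; apply/negP/indepD.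
Qed.

(** An out-neighbour of [x] has itself an out-neighbour outside [Y], so [second] loses at least 2 to
    the out-degree inside [Y]. This contradicts [far_out] unless the far set is empty. *)
Lemma out_large x : x \notin Y -> d < #|out_in D Y x|.
Proof.
move=> xY; have := second_lt x; rewrite out_compl_indep // addn0 => lt1.
have /card_gt0P[a] : 0 < #|out_in D Y x| by apply: leq_ltn_trans lt1.
rewrite inE => /andP[aY Dxa].
have /card_gt0P[x'] := out_compl_gt0 aY; rewrite !inE => /andP[x'Y Dax'].
have : 0 < #|out_in second (~: Y) x|.
  apply/card_gt0P; exists x'; rewrite !inE x'Y /second indepD //=.
  by apply/existsP; exists a; rewrite aY Dxa.
have := card_out_in_split Y x; rewrite cardY; have := @far_out x.
case: #|out_in far Y x| => [|n] le1; last have {le1} := le1 isT; lia.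
Qed.

Lemma second_compl_out x : x \notin Y ->
  #|out_in second (~: Y) x| + d.*2 < #|out_in D Y x|.*2.
Proof.
move=> xY; have := second_lt x; rewrite out_compl_indep // addn0.
have := out_large xY; have := card_out_in_split Y x; rewrite cardY.
have := @far_out x.
case: #|out_in far Y x| => [|n] le1; last have {le1} := le1 isT; lia.
Qed.

(** * In-neighbourhoods of the vertices outside [Y] *)

Lemma in_add_out x : x \notin Y ->
  #|out_in (rev_rel D) Y x| + #|out_in D Y x| <= d.*2.
Proof.
move=> xY; rewrite -cardY !card_out_in -big_split -sum1_card /=.
apply: leq_sum => v _; rewrite /rev_rel.
by case: (boolP (D v x)) => [/asymD/negPf->|_] //; case: (D x v).
Qed.

Lemma in_far_dom x : {in out_in (rev_rel D) Y x & out_in (rev_rel far) Y x,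
  forall a b, D a b}.
Proof.
move=> a b; rewrite !inE /rev_rel => /andP[aY Dax] /and3P[bY nDbx /existsPn nr].
apply: (tournamentP bY aY); first by apply: contraNneq nDbx => ->.
by have := nr a; rewrite aY Dax andbT.
Qed.

(** In the reversed tournament the far set dominates the in-neighbourhood. *)
Lemma in_far_card x : 0 < #|out_in (rev_rel far) Y x| ->
  #|out_in (rev_rel D) Y x|.*2 + #|out_in (rev_rel far) Y x| <= d.*2.+1.
Proof.
apply: (dominating_card (tournament_on_rev tY)).
- by apply/subsetP => z; rewrite inE => /andP[].
- by apply/subsetP => z; rewrite inE => /andP[].
- by move=> b a bF aI; apply: (@in_far_dom x).
- by move=> b; rewrite inE => /andP[/inY].
Qed.

Lemma in_second_card x : x \notin Y ->
  #|out_in (rev_rel D) Y x| <= #|out_in (rev_rel second) Y x|.+1.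
Proof.
move=> xY; have := card_in_in_split Y x; rewrite cardY.
have := in_add_out xY; have := out_large xY; have := @in_far_card x.
case: #|out_in (rev_rel far) Y x| => [|n] le1; last have {le1} := le1 isT; lia.
Qed.

Definition tight :=
  [set x in ~: Y | #|out_in (rev_rel second) Y x| < #|out_in (rev_rel D) Y x|].

Lemma sum_gain_le_tight :
  \sum_(y in Y) (low y + (low y && (blockers y == set0))) <= #|tight|.
Proof.
have : \sum_(y in Y) (#|out_in second (~: Y) y| +
   (low y + (low y && (blockers y == set0)))) <= \sum_(y in Y) #|out_in D (~: Y) y|.
  by apply: leq_sum => y yY; rewrite addnA second_gain.
rewrite big_split /= (sum_card_out_in second) (sum_card_out_in D).
have : \sum_(x in ~: Y) #|out_in (rev_rel D) Y x| <=
  \sum_(x in ~: Y) (#|out_in (rev_rel second) Y x| + (x \in tight)).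
  apply: leq_sum => x xY; rewrite inE xY /=.
  by rewrite inE in xY; have := in_second_card xY; case: ltnP => /=; lia.
rewrite big_split /= => le1 le2.
have -> : #|tight| = \sum_(x in ~: Y) (x \in tight).
  rewrite -sum1_card [RHS](bigID (mem tight)) /= [X in _ + X]big1 ?addn0.
    apply: eq_big => [x|x ->] //; rewrite inE.
    by case: (x \in ~: Y).
  by move=> x /andP[_ /negPf->].
by move: (leq_trans le2 le1); rewrite leq_add2l.
Qed.

(** * Structure around a tight vertex *)

Section Tight.

Variable x : T.
Hypothesis tx : x \in tight.

Lemma tightN : x \notin Y.
Proof. by move: tx; rewrite !inE => /andP[]. Qed.

Lemma tight_in : #|out_in (rev_rel D) Y x| = #|out_in (rev_rel second) Y x|.+1.
Proof.
move: tx; rewrite inE => /andP[_ ltx]; apply/eqP; rewrite eqn_leq ltx andbT.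
exact/in_second_card/tightN.
Qed.

Lemma tight_far :
  #|out_in (rev_rel D) Y x|.*2 + #|out_in (rev_rel far) Y x| = d.*2.+1.
Proof. by have := card_in_in_split Y x; rewrite cardY tight_in; lia. Qed.

(** The domination count is applied in the original orientation, where in-neighbours dominate the
    far set; [tight_far] then eliminates the far set. *)
Lemma tight_in_ge : d.*2 < 3 * #|out_in (rev_rel D) Y x|.
Proof.
have : #|out_in (rev_rel far) Y x|.*2 + #|out_in (rev_rel D) Y x| <= d.*2.+1.
  apply: (dominating_card tY).
  - by apply/subsetP => z; rewrite inE => /andP[].
  - by apply/subsetP => z; rewrite inE => /andP[].
  - exact: in_far_dom.
  - by move=> b; rewrite inE => /andP[/outY].
  - by rewrite tight_in.
by have := tight_far; lia.
Qed.

Lemma tight_far_in b : b \in out_in (rev_rel far) Y x ->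
  #|out_in (rev_rel D) Y b| = d /\ out_in (rev_rel D) Y b
    \subset out_in (rev_rel D) Y x :|: out_in (rev_rel far) Y x.
Proof.
apply: (dominating_card_eq (tournament_on_rev tY)).
- by apply/subsetP => z; rewrite inE => /andP[].
- by apply/subsetP => z; rewrite inE => /andP[].
- by move=> c a cF aI; apply: (@in_far_dom x).
- by move=> c; rewrite inE => /andP[/inY].
- exact: tight_far.
Qed.

Lemma tight_far_low b : b \in out_in (rev_rel far) Y x -> low b.
Proof.
move=> bF; have bY : b \in Y by move: bF; rewrite inE => /andP[].
have [ib _] := tight_far_in bF; have := out_addn_in bY; have := out_low bY.
by rewrite ib; case: low => //=; lia.
Qed.

(** A blocker [z] of [b] is not low, hence is an in-neighbour of [x] and dominates the far set. It
    also dominates the second in-neighbours of [x], since [b] does. Its out-degree would then exceed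
    [d]. *)
Lemma tight_far_blockers b : b \in out_in (rev_rel far) Y x -> blockers b = set0.
Proof.
move=> bF; have bY : b \in Y by move: bF; rewrite inE => /andP[].
apply/eqP/set0Pn => -[z zB]; have /andP[_ hz] := blocker_low bY zB.
have [zY Dzb] : z \in Y /\ D z b by move: zB; rewrite inE => /and3P[].
have [_ /subsetP sb] := tight_far_in bF.
have zI : z \in out_in (rev_rel D) Y x.
  have /sb : z \in out_in (rev_rel D) Y b by rewrite inE zY.
  by rewrite inE => /orP[//|/tight_far_low]; rewrite (negPf hz).
have : out_in (rev_rel second) Y x :|: out_in (rev_rel far) Y x
   \subset out_in D Y z.
  apply/subsetP => c; rewrite inE => /orP[cC|cF]; last first.
    rewrite inE (in_far_dom zI cF) andbT.
    by move: cF; rewrite inE => /andP[].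
  have cY : c \in Y by move: cC; rewrite inE => /andP[].
  apply: (subsetP (blocker_out bY zB)); rewrite !inE cY /=; apply/orP; right.
  have : c \notin out_in (rev_rel D) Y b.
    apply/negP => /sb; move: cC; rewrite !inE cY /= /rev_rel /second /far.
    by case: (D c x); case: (reach2 c x).
  rewrite inE cY /= => nDcb; apply: (tournamentP cY bY) => //.
  apply: contraTneq cC => ->; move: bF; rewrite !inE /rev_rel /second /far bY /=.
  by case: reach2; rewrite ?andbF.
move/subset_leq_card; rewrite cardsU.
have -> : out_in (rev_rel second) Y x :&: out_in (rev_rel far) Y x = set0.
  apply/setP => c; rewrite !inE /rev_rel /second /far.
  by case: reach2; rewrite ?andbF.
rewrite cards0 subn0; have := outY zY; have := in_add_out tightN.
have := out_large tightN; have := tight_in; have := tight_far; lia.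
Qed.

Lemma card_tight : d + #|out_in (rev_rel far) Y x| <= #|tight|.
Proof.
apply: leq_trans sum_gain_le_tight; rewrite big_split /= card_low leq_add2l.
rewrite card_out_in; apply: leq_sum => y yY; rewrite /rev_rel.
case: (boolP (far y x)) => // fyx.
have yF : y \in out_in (rev_rel far) Y x by rewrite inE yY.
by rewrite tight_far_low // tight_far_blockers ?eqxx.
Qed.

End Tight.

(** * The count over the out-neighbourhood of one tight vertex *)

(* The contribution of [x'] to the sum over the out-neighbourhood of [x], scaled
   by 3 because [tight_in_ge] bounds three times the in-degree. *)
Lemma in_out_cap x x' : x \notin Y -> x' \notin Y ->
  3 * #|out_in (rev_rel D) (out_in D Y x) x'|
    + ((x' \in tight) && ~~ second x x') * (3 * #|out_in D Y x| - d.*2.+1)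
  <= 3 * #|out_in (rev_rel second) (out_in D Y x) x'|
    + second x x' * (3 * (d.*2.+1 - #|out_in D Y x|)).
Proof.
move=> xY x'Y; set W := out_in D Y x.
have sWY : W \subset Y by apply/subsetP => z; rewrite inE => /andP[].
have mono E : #|out_in E W x'| <= #|out_in E Y x'|.
  apply/subset_leq_card/subsetP => z; rewrite !inE => /andP[/andP[-> _] ->].
  by [].
have leI := mono (rev_rel D); have leF := mono (rev_rel far).
have := card_in_in_split W x'; have := in_far_card; have := in_add_out x'Y.
have := out_large x'Y; have := out_large xY; have := in_add_out xY.
move=> h1 h2 h3 h4 /(_ x') h5 h6.
case: (boolP (second x x')) => s; rewrite ?andbF ?andbT /= ?mul0n ?mul1n.
  (* With [I], [S], [F] the in-, second and far parts of [W], [I - S = 2I + F - #|W|], and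
     [2I + F <= 2d + 1] by [in_far_card] or, if nothing is far, by [I < d]. *)
  rewrite addn0; case: (posnP #|out_in (rev_rel far) Y x'|) => [|/h5]; lia.
have I0 : #|out_in (rev_rel D) W x'| = 0.
  apply/eqP; rewrite cards_eq0; apply/eqP/setP => w; rewrite !inE.
  apply/negP => /andP[/andP[wY Dxw] Dwx']; case/negP: s.
  rewrite /second indepD //=; apply/existsP; exists w; rewrite wY Dxw.
  exact: Dwx'.
case: (boolP (x' \in tight)) => [tx'|_]; last by rewrite I0.
(* Tightness and [tight_in_ge] bound three times the far set by [2d + 1]; the rest of [W] lies in
   [second]. *)
have := tight_far tx'.
have := tight_in_ge tx'; rewrite mul1n -/W; lia.
Qed.

(** The conclusion cannot be [False]: on an empty vertex type the hypotheses hold vacuously. *)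
Lemma seymour_free_empty : d = 0.
Proof.
apply/eqP; rewrite -leqn0 leqNgt; apply/negP => d0.
have /card_gt0P[x tx] : 0 < #|tight|.
  apply: leq_trans sum_gain_le_tight; rewrite big_split /= card_low.
  exact: leq_trans d0 (leq_addr _ _).
have xY := tightN tx; pose W := out_in D Y x.
have : \sum_(y in W) #|out_in second (~: Y) y| <= \sum_(y in W) #|out_in D (~: Y) y|.
  apply: leq_sum => y; rewrite inE => /andP[yY _].
  by apply: leq_trans (second_gain yY); rewrite -addnA leq_addr.
rewrite (sum_card_out_in second) (sum_card_out_in D) => le1.
have : \sum_(x' in ~: Y) (3 * #|out_in (rev_rel D) W x'|
    + ((x' \in tight) && ~~ second x x') * (3 * #|W| - d.*2.+1))
  <= \sum_(x' in ~: Y) (3 * #|out_in (rev_rel second) W x'|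
    + second x x' * (3 * (d.*2.+1 - #|W|))).
  by apply: leq_sum => x' x'Y; apply: in_out_cap; rewrite // -in_setC.
have mulr a (F : T -> nat) : \sum_(x' in ~: Y) a * F x' = a * \sum_(x' in ~: Y) F x'.
  by rewrite big_distrr.
have mull a (F : T -> nat) : \sum_(x' in ~: Y) F x' * a = (\sum_(x' in ~: Y) F x') * a.
  by rewrite big_distrl.
rewrite big_split [leqRHS]big_split /= !mulr !mull -card_out_in => le2.
have := second_compl_out xY; have := card_tight tx; have := tight_far tx.
have := tight_in_ge tx; have := in_add_out xY; have := out_large xY.
have : #|tight| <= \sum_(x' in ~: Y) ((x' \in tight) && ~~ second x x')
                   + #|out_in second (~: Y) x|.
  rewrite card_out_in -big_split /= -sum1_card big_mkcond [leqRHS]big_mkcond /=.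
  apply: leq_sum => x' _; case: (boolP (x' \in tight)) => // tx'.
  by rewrite in_setC (tightN tx') /=; case: second.
move: le1 le2; rewrite -/W.
move: #|tight| #|W| #|out_in (rev_rel D) Y x| #|out_in (rev_rel far) Y x|.
move: #|out_in second _ x| (\sum_(_ in _) _) (\sum_(_ in _) _) (\sum_(_ in _) _).
move=> n2 c i n1 m w k f le1 le2 le3 dw kw dk kf df n2w.
have [t wE] : exists t, w = d + t by exists (w - d); lia.
(* Here [3 * t + 1 <= d] follows from [3 * i > 2d] and [w + i <= 2d]. *)
have [s dE] : exists s, d = 3 * t + 1 + s by exists (d - (3 * t + 1)); lia.
have le4 : c * (6 * t + s) <= n2 * (3 * (2 * t + 2 + s)).
  have -> : 6 * t + s = 3 * w - d.*2.+1 by lia.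
  have -> : 2 * t + 2 + s = d.*2.+1 - w by lia.
  by lia.
(* The factor [3 * t + 3 + s] is [d + 2]: there are at least [d + 2t + 1] tight vertices, and at
   most [2t - 1] of them are reached. *)
have : (3 * t + 3 + s) * (6 * t + s) <= c * (6 * t + s).
  by rewrite leq_mul2r; apply/orP; right; lia.
have : n2 * (3 * (2 * t + 2 + s)) <= (2 * t) * (3 * (2 * t + 2 + s)).
  by rewrite leq_mul2r; apply/orP; right; lia.
(* Strictness: the lower product exceeds the upper one by [6t^2 + 3ts + 6t + 3s + s^2]. *)
have : 0 < t by lia.
nia.
Qed.

End SeymourFree.

(** * Transfer from the induced tournament and conclusion *)

Lemma card_induced (T : finType) (E : rel T) (Y : {set T})
    (x : {x : T | x \in Y}) :
  #|[set v | relpre val E x v]| = #|out_in E Y (val x)|.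
Proof.
rewrite -(card_imset _ val_inj); apply: eq_card => v.
rewrite inE; apply/imsetP/andP => [[u]|[vY Exv]].
  by rewrite inE => Exu ->; split=> //; apply: valP.
by exists (Sub v vY); rewrite ?inE ?SubK.
Qed.

Theorem theorem4p10 (T : finType) (D : rel T) (X Y : {set T}) (d : nat)
    (hT : 0 < #|T|)
    (hD : oriented D)
    (hXYU : X :|: Y = [set: T])
    (hXYI : [disjoint X & Y])
    (hX : independent D X)
    (hYt : tournament (induced D Y))
    (hYr : almost_regular (induced D Y))
    (hYd : #|Y| = 2 * d) :
  exists u : T, seymour_vertex D u.
Proof.
have [/existsP[u su]|nS] := boolP [exists u, #|out_nbhd D u| <= #|out_nbhd2 D u|].
  by exists u.
have not_seymour u : #|out_nbhd2 D u| < #|out_nbhd D u|.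
  by rewrite ltnNge; move/existsPn: nS; apply.
have [_ asymD] := hD.
have inX x : x \notin Y -> x \in X.
  by move=> xY; have := in_setT x; rewrite -hXYU inE (negPf xY) orbF.
have indepD x y : x \notin Y -> y \notin Y -> ~~ D x y.
  by move=> /inX xX /inX yX; apply: hX.
have cardY : #|Y| = d.*2 by rewrite hYd mul2n.
have tY : tournament_on D Y.
  move=> x y xY yY; case: eqVneq => [->|nxy] /=.
    by have [irr _] := hD; rewrite irr.
  have := hYt.2 (Sub x xY) (Sub y yY); rewrite -val_eqE /= => /(_ nxy).
  rewrite /induced /=; have := asymD x y.
  by case: (D x y) => [/(_ isT)/negPf->//|_]; case: (D y x).
(* The two degrees differ by 1 and sum to [2d - 1], so they are [d] and [d - 1]. *)
have degY : {in Y, forall y, #|out_in D Y y| <= d /\ #|out_in (rev_rel D) Y y| <= d}.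
  move=> y yY; have := out_addn_in asymD tY cardY yY.
  have := hYr (Sub y yY); rewrite /out_nbhd /in_nbhd /induced.
  rewrite (card_induced D) (card_induced (rev_rel D)) /=; lia.
have outY : {in Y, forall y, #|out_in D Y y| <= d} by move=> y /degY[].
have inY : {in Y, forall y, #|out_in (rev_rel D) Y y| <= d} by move=> y /degY[].
have d0 := seymour_free_empty asymD indepD tY outY inY cardY not_seymour.
(* With [Y] empty there are no arcs, and any vertex is trivially Seymour. *)
have Y0 : Y = set0 by apply/eqP; rewrite -cards_eq0 cardY d0.
have /card_gt0P[u _] := hT.
have := not_seymour u; suff -> : out_nbhd D u = set0 by rewrite cards0.
by apply/setP => v; rewrite !inE; apply/negbTE/indepD; rewrite Y0 inE.
Qed.
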